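(* For every even integer $n>2$ there exists a set of $n^2$ points in the plane and $3n+3$ distinct lines each of which contains exactly $n$ points of the set; that is, $t_n(n^2)\ge 3n+3$.
   Context: All points and lines are in the real plane $\mathbf{R}^2$. For a finite set $S$ of points in the plane, $t_k(S)$ denotes the number of lines meeting $S$ in exactly $k$ points, and $t_k(m)$ denotes the maximum of $t_k(S)$ over all sets $S$ of $m$ points in the plane. *)

(* Defs.v *)
From HB Require Import structures.
From mathcomp Require Import all_boot all_order all_algebra finmap.
From mathcomp Require Import boolp classical_sets functions cardinality reals.
Set Implicit Arguments.
Unset Strict Implicit.
Unset Printing Implicit Defensive.
Import Order.TTheory GRing.Theory Num.Theory.
Local Open Scope classical_set_scope.
Local Open Scope fset_scope.
Local Open Scope nat_scope.

Definition is_line (R : realType) (L : set (R * R)) : Prop :=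
  exists a b c : R, (a, b) <> (0, 0)%R /\
    L = [set p : R * R | (a * p.1 + b * p.2 = c)%R].

Definition rich_lines (R : realType) (k : nat) (S : {fset R * R}) :
    set (set (R * R)) :=
  [set L | is_line L /\ #|` [fset p in S | p \in L]| = k].

(* t_k(S). [fset_set] sends infinite sets to the empty set; the set of lines
   is finite as soon as k >= 2, because two points determine a line. *)
Definition num_rich_lines (R : realType) (k : nat) (S : {fset R * R}) : nat :=
  #|` fset_set (rich_lines k S)|.

Definition is_max_rich (R : realType) (k m t : nat) : Prop :=
  (exists S : {fset R * R}, #|` S| = m /\ num_rich_lines k S = t) /\
  (forall S : {fset R * R}, #|` S| = m -> num_rich_lines k S <= t).

(* t_k(m). The default value 0 is returned only if there is no maximum;
   for k >= 2 the maximum exists since t_k(S) <= 'C(m, 2). *)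
Definition max_rich_lines (R : realType) (k m : nat) : nat :=
  xget 0 [set t | is_max_rich R k m t].

(* Main.v *)
Require Import Defs.
From HB Require Import structures.
From mathcomp Require Import all_boot all_order all_algebra finmap.
From mathcomp Require Import boolp classical_sets functions cardinality reals.
From mathcomp Require Import trigo.
From mathcomp Require Import zify ring lra.
Set Implicit Arguments.
Unset Strict Implicit.
Unset Printing Implicit Defensive.
Import Order.TTheory GRing.Theory Num.Theory.
Local Open Scope classical_set_scope.
Local Open Scope fset_scope.
Local Open Scope nat_scope.

(** Write n = 2h, let m = n + 1 (an odd number) and let u_0, ..., u_(m-1) be
    the unit vectors at the angles 2 pi c / m.  Take the m symmetry axes of the
    regular m-gon, its m side lines u_i . p = 1, and the m lines u_i . p = k of
    a homothetic copy.  As m is odd, no two of the side lines are parallel, and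
    the side lines i and j meet on an axis: the side line i meets the axis c,
    for c <> i, at u_c / cos (2 pi (c - i) / m).  So each side line meets the
    other ones in n distinct points, and the crossing points of the side lines
    form h orbits under rotation, at the signed distances
    1 / cos (2 pi d / m), 1 <= d <= h, along the u_c.  The second copy
    gives h more orbits, at distances k / cos (2 pi d / m).

    If the two sets of distances have exactly one common element, there are
    2h - 1 = n - 1 orbits in all, and together with the center they make
    (n + 1) (n - 1) + 1 = n ^ 2 points.  Each axis then carries the center and
    one point of each orbit, which is n points.  A side line meets the axes
    c <> i in n points of the set, and it has no other point in the set as long
    as 1, its distance along its own axis i, is not the distance of an orbit;
    likewise for the copy and k.  This gives 3m = 3n + 3 lines.  For n = 4 it is
    the classical pentagram configuration of 16 points on 15 lines.

    It remains to choose k.  Up to sign, the numbers cos (2 pi d / m) are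
    sin (j x) for x = pi / (2m) and j = 1, 3, ..., m - 2, each once.  Let k be
    the signed ratio of the largest to the smallest in absolute value.
    Multiplying by k then sends the smallest distance to the largest and the
    other ones beyond it, in absolute value, so there is exactly one coincidence
    ([radii_overlap]); 1 is not a distance since distances exceed 1 in absolute
    value ([one_notin_radii]).  If k were a distance, sin x / cos (2x) would be
    some sin (j x) with j odd, but it lies strictly between sin x and
    sin (3x) ([star_ratio_neqV], [star_ratio_notin_radii]).

    The bound on the maximal number of rich lines follows because this maximum
    is attained: a line with at least two points of S is determined by its trace
    on S, so there are at most 2 ^ #|S| such lines. *)

(** * Cosines of the multiples of 2 pi / m *)

Section Cosines.
Variables (R : realType) (h : nat).
Hypothesis h_gt1 : 1 < h.
Let m := h.*2.+1.
Local Open Scope ring_scope.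

(** The unit in which all angles are counted: m units make a right angle, and
    4 units a step of the regular m-gon. *)
Definition sector : R := pi / m.*2%:R.

Definition angle (d : nat) : R := (4 * d)%:R * sector.

Definition vertex_cos (d : nat) : R := cos (angle d).

(** The distance from 4 d to m, in truncated subtraction. *)
Definition gap (d : nat) : nat := (m - 4 * d) + (4 * d - m).

Let sine (k : nat) : R := sin (k%:R * sector).

Lemma sector_gt0 : 0 < sector.
Proof. by rewrite divr_gt0 ?pi_gt0 ?ltr0n // double_gt0. Qed.

Lemma sector_pihalf : m%:R * sector = pi / 2.
Proof.
have m0 : m%:R != 0 :> R by rewrite pnatr_eq0.
by rewrite /sector -muln2 natrM; field.
Qed.

Lemma sine_lt (j k : nat) : (j < k)%N -> (k <= m)%N -> sine j < sine k.
Proof.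
move=> jk km; have x0 := sector_gt0.
have itv (i : nat) : (i <= m)%N -> i%:R * sector \in `[- (pi / 2), pi / 2]%R.
  move=> im; rewrite in_itv /= -sector_pihalf ler_pM2r // ler_nat im andbT.
  by apply: (@le_trans _ _ 0); rewrite ?oppr_le0 mulr_ge0 ?ler0n ?ltW.
rewrite /sine ltr_sin ?itv //; last exact: leq_trans (ltnW jk) km.
by rewrite ltr_pM2r // ltr_nat.
Qed.

Lemma sine_le (j k : nat) : (j <= k)%N -> (k <= m)%N -> sine j <= sine k.
Proof.
by rewrite leq_eqVlt => /orP[/eqP-> //|jk km]; rewrite ltW // sine_lt.
Qed.

Lemma sine0 : sine 0 = 0. Proof. by rewrite /sine mul0r sin0. Qed.

Lemma sine_m : sine m = 1.
Proof. by rewrite /sine sector_pihalf sin_pihalf. Qed.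

(** The angle 4 d differs from the right angle m by [gap d] units. *)
Lemma normr_vertex_cos d :
  (d <= h)%N -> `|vertex_cos d| = sine (gap d).
Proof.
move=> dh.
have sine_ge0 (k : nat) : (k <= m)%N -> 0 <= sine k.
  by move=> km; rewrite -sine0 sine_le.
have -> : vertex_cos d = sin (m%:R * sector - (4 * d)%:R * sector).
  by rewrite sector_pihalf -[_ - _]opprB sinN sinBpihalf opprK.
rewrite -mulrBl /gap; have [le_md|/ltnW le_dm] := leqP m (4 * d).
  rewrite -opprB mulNr sinN normrN -natrB //.
  have -> : (m - 4 * d = 0)%N by lia.
  by rewrite ger0_norm // sine_ge0 //; lia.
rewrite -natrB //; have -> : (4 * d - m = 0)%N by lia.
by rewrite addn0 ger0_norm // sine_ge0 //; lia.
Qed.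

Lemma gap_bounds d : (0 < d <= h)%N -> (0 < gap d <= m - 2)%N.
Proof. rewrite /gap; lia. Qed.

Lemma gap_not2 d : gap d != 2%N.
Proof. rewrite /gap; lia. Qed.

(** Equal gaps on opposite sides of m would give 4 (d + e) = 2 m, which is
    impossible for m odd. *)
Lemma gap_inj d e : gap d = gap e -> d = e.
Proof. rewrite /gap; lia. Qed.

Lemma vertex_cosC d :
  (d <= m)%N -> vertex_cos (m - d) = vertex_cos d.
Proof.
move=> dm; rewrite /vertex_cos /angle.
have -> : (4 * (m - d))%:R * sector = - ((4 * d)%:R * sector) + pi *+ 2 :> R.
  rewrite mulnBr natrB ?leq_mul2l // mulrBl [(4 * m)%:R]natrM -mulrA.
  by rewrite sector_pihalf -mulr_natr; field.
by rewrite cosD2pi cosN.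
Qed.

Lemma vertex_cos_neq0 d : (d < m)%N -> vertex_cos d != 0.
Proof.
wlog dh : d / (d <= h)%N => [hwlog dm|_].
  case: (leqP d h) => [/hwlog -> //|hd].
  by rewrite -vertex_cosC ?hwlog ?(ltnW dm) //; lia.
rewrite -normr_eq0 normr_vertex_cos // gt_eqF // -sine0 sine_lt //.
all: rewrite /gap; lia.
Qed.

Lemma normr_vertex_cos_lt1 d : (0 < d < m)%N -> `|vertex_cos d| < 1.
Proof.
wlog dh : d / (d <= h)%N => [hwlog dm|/andP[d0 _]].
  case: (leqP d h) => [/hwlog -> //|hd].
  by rewrite -vertex_cosC ?hwlog //; lia.
rewrite normr_vertex_cos // -sine_m sine_lt //.
have := @gap_bounds d; lia.
Qed.

Lemma vertex_cos_inj : {in [pred d | (0 < d <= h)%N] &, injective vertex_cos}.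
Proof.
move=> d e /=; rewrite !inE => dh eh /(congr1 Num.norm).
rewrite !normr_vertex_cos; [|lia..].
have := gap_bounds dh; have := gap_bounds eh => gd ge eqs; apply: gap_inj.
case: (ltngtP (gap d) (gap e)) => // lt_de.
  by have := sine_lt lt_de; rewrite eqs ltxx; lia.
by have := sine_lt lt_de; rewrite eqs ltxx; lia.
Qed.

(** The index d for which 4 d is closest to m, that is, for which the cosine is
    smallest in absolute value. *)
Definition nearest : nat := h.+1./2.

Lemma nearest_bounds : (0 < nearest <= h)%N.
Proof. rewrite /nearest; lia. Qed.

Lemma gap_nearest : gap nearest = 1%N.
Proof. rewrite /gap /nearest; lia. Qed.

Lemma gap_h : gap h = (m - 2)%N.
Proof. rewrite /gap; lia. Qed.

(** The index h is the one with the largest gap, so this is the largest ratio of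
    two of the cosines, in absolute value. *)
Definition star_ratio : R := vertex_cos h / vertex_cos nearest.

Lemma vertex_cos_h_neq0 : vertex_cos h != 0.
Proof. by rewrite vertex_cos_neq0 //; lia. Qed.

Lemma vertex_cos_nearest_neq0 : vertex_cos nearest != 0.
Proof. by rewrite vertex_cos_neq0 //; have := nearest_bounds; lia. Qed.

Lemma normr_star_ratio_gt1 : 1 < `|star_ratio|.
Proof.
have nb := nearest_bounds.
rewrite /star_ratio normrM normfV !normr_vertex_cos //; last lia.
rewrite gap_nearest gap_h ltr_pdivlMr ?mul1r ?sine_lt //; [lia..|].
by rewrite -sine0 sine_lt.
Qed.

(** The equality says cos_h cos_e = cos_d cos_nearest, where |cos_d| <= |cos_h|
    and |cos_nearest| <= |cos_e|; hence the last one is an equality. *)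
Lemma star_ratio_coincidence d e :
  (0 < d <= h)%N -> (0 < e <= h)%N ->
  star_ratio / vertex_cos d = (vertex_cos e)^-1 -> e = nearest.
Proof.
move=> dh eh.
have d0 : vertex_cos d != 0 by rewrite vertex_cos_neq0 //; lia.
have e0 : vertex_cos e != 0 by rewrite vertex_cos_neq0 //; lia.
have a0 := vertex_cos_nearest_neq0.
have nb := nearest_bounds.
move=> eq_de.
have {eq_de} : vertex_cos h * vertex_cos e =
    vertex_cos d * vertex_cos nearest.
  have -> : vertex_cos h * vertex_cos e =
      star_ratio / vertex_cos d * (vertex_cos d * vertex_cos nearest)
      * vertex_cos e.
    by rewrite /star_ratio; field; apply/andP.
  by rewrite eq_de; field.
move=> /(congr1 Num.norm); rewrite !normrM !normr_vertex_cos; [|lia..].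
rewrite gap_h gap_nearest => eq_s; apply: gap_inj; rewrite gap_nearest.
have gd := gap_bounds dh; have ge := gap_bounds eh.
case: (ltngtP (gap e) 1) => // [|ge1]; first lia.
have s1 : 0 < sine 1 by rewrite -sine0 sine_lt //; lia.
have lt_e : sine 1 < sine (gap e) by rewrite sine_lt //; lia.
have le_d : sine (gap d) <= sine (m - 2) by rewrite sine_le //; lia.
have sh : 0 < sine (m - 2) by rewrite -sine0 sine_lt //; lia.
exfalso; nra.
Qed.

(** Otherwise sin (g x) sin ((m - 2) x) = sin x with x the unit angle and g odd.
    The second factor is cos (2 x) < 1, so g <> 1; but for g >= 3 the product is
    at least sin (3 x) cos (2 x) = (sin (5 x) + sin x) / 2 > sin x. *)
Lemma star_ratio_neqV d : (0 < d <= h)%N -> star_ratio != (vertex_cos d)^-1.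
Proof.
move=> dh; apply/eqP => /(congr1 Num.norm).
have nb := nearest_bounds.
have x0 := sector_gt0.
have xm := sector_pihalf.
rewrite /star_ratio normrM !normfV !normr_vertex_cos; [|lia..].
rewrite gap_h gap_nearest => eq_s.
have gd := gap_bounds dh.
have s1 : 0 < sine 1 by rewrite -sine0 sine_lt //; lia.
have sd : 0 < sine (gap d) by rewrite -sine0 sine_lt //; lia.
have {eq_s} eq_s : sine (gap d) * sine (m - 2) = sine 1.
  have s10 := lt0r_neq0 s1; have sd0 := lt0r_neq0 sd.
  have -> : sine (m - 2) = sine (m - 2) / sine 1 * sine 1 by field.
  by rewrite eq_s; field.
have lt1 : sine (m - 2) < 1 by rewrite -sine_m sine_lt //; lia.
case: (ltngtP (gap d) 1) => [|gd1|gd1]; first lia; last first.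
  by move: eq_s; rewrite gd1 => eq_s; nra.
have le3 : sine 3 <= sine (gap d).
  by rewrite sine_le //; have := gap_not2 d; lia.
have lt5 : sine 1 < sine 5 by rewrite sine_lt //; lia.
have sh : 0 < sine (m - 2) by rewrite -sine0 sine_lt //; lia.
have prod : sine 3 * sine (m - 2) *+ 2 = sine 5 + sine 1.
  have -> : sine (m - 2) = cos (2%:R * sector).
    rewrite /sine natrB; last lia.
    by rewrite mulrBl xm -opprB sinN sinBpihalf opprK.
  have -> : sine 5 = sin (3%:R * sector + 2%:R * sector).
    by rewrite /sine -mulrDl -natrD.
  have -> : sine 1 = sin (3%:R * sector - 2%:R * sector).
    by rewrite /sine -mulrBl -natrB.
  by rewrite sinD sinB /sine; ring.
nra.
Qed.

End Cosines.

(** * Cardinals and traces of finite sets *)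

Lemma card_imfset_fin (T : finType) (K : choiceType) (f : T -> K)
    (A : {pred T}) :
  {in A &, injective f} -> #|` [fset f x | x in A]| = #|A|.
Proof.
move=> f_inj; rewrite card_in_imfset // -[LHS](card_uniqP (enum_finmem_uniq _)).
by apply: eq_card => x; rewrite enum_finmemE.
Qed.

Lemma mem_fset_on_line (R : realType) (S : {fset R * R}) (L : set (R * R)) p :
  (p \in [fset q in S | q \in L]) = (p \in S) && (p \in L).
Proof. by rewrite !inE. Qed.

(** * Lines in normal form *)

Section Lines.
Variable R : realType.
Local Open Scope ring_scope.

Definition polar (a r : R) : R * R := (r * cos a, r * sin a).

(** The parameter [t] is the angle of a unit normal, [s] the signed distance
    from the origin. *)
Definition normal_line (t s : R) : set (R * R) :=
  [set p | cos t * p.1 + sin t * p.2 = s].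

Lemma is_line_normal_line t s : is_line (normal_line t s).
Proof.
exists (cos t), (sin t), s; split=> // -[c0 s0].
have /eqP := cos2Dsin2 t; rewrite c0 s0 expr0n /= addr0.
by rewrite eq_sym oner_eq0.
Qed.

Lemma polar_normal_line a r t s :
  (polar a r \in normal_line t s) = (r * cos (a - t) == s).
Proof.
apply/idP/eqP; rewrite !inE /normal_line /= cosB => <-; ring.
Qed.

Lemma origin_normal_line t s : ((0, 0) \in normal_line t s) = (s == 0).
Proof.
rewrite (_ : (0, 0) = polar 0 0) ?polar_normal_line ?mul0r 1?eq_sym //.
by rewrite /polar !mul0r.
Qed.

End Lines.

(** * The star configuration *)

Section Star.
Variables (R : realType) (h : nat).
Hypothesis h_gt1 : 1 < h.
Notation m := h.*2.+1.
Notation dir := (angle R h).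
Notation vcos := (vertex_cos R h).
Local Open Scope ring_scope.

Lemma cos_angleB (i j : nat) :
  cos (dir i - dir j) = vcos ((i - j) + (j - i)).
Proof.
rewrite /vertex_cos /angle; case: (leqP i j) => [ij|/ltnW ji].
  have -> : (i - j = 0)%N by lia.
  by rewrite -cosN opprB -mulrBl -natrB ?leq_mul2l // -mulnBr.
have -> : (j - i = 0)%N by lia.
by rewrite addn0 -mulrBl -natrB ?leq_mul2l // -mulnBr.
Qed.

Lemma cos_angleB_neq0 (i j : 'I_m) : cos (dir i - dir j) != 0.
Proof.
by rewrite cos_angleB vertex_cos_neq0 //; case: i j => i ? [j ?] /=; lia.
Qed.

(** As m is odd, opposite directions never both occur, so the value -1 is
    excluded along with 1. *)
Lemma normr_cos_angleB (i j : 'I_m) : `|cos (dir i - dir j)| = 1 -> i = j.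
Proof.
move=> /eqP cij; apply/eqP; apply: contraLR cij => nij.
rewrite cos_angleB lt_eqF // normr_vertex_cos_lt1 //.
by move: nij; rewrite -val_eqE; case: i j => i ? [j ?] /=; lia.
Qed.

(** Two multiples r u_i and s u_j that are the orthogonal projections of each
    other are equal: r cos ^ 2 = r forces the angle to be trivial. *)
Lemma mutual_projection (i j : 'I_m) (r s : R) : r != 0 ->
  r * cos (dir i - dir j) = s -> s * cos (dir j - dir i) = r -> i = j /\ r = s.
Proof.
rewrite -[dir j - dir i]opprB cosN => r0 rs sr.
have ij : i = j.
  apply: normr_cos_angleB; apply/eqP; rewrite -sqrp_eq1 // -normrX.
  rewrite ger0_norm ?sqr_ge0 //; apply/eqP/(mulfI r0).
  by rewrite mulr1 expr2 mulrA rs sr.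
by split=> //; rewrite -rs ij subrr cos0 mulr1.
Qed.

Lemma polar_inj (i j : 'I_m) (r s : R) : r != 0 ->
  polar (dir i) r = polar (dir j) s -> i = j /\ r = s.
Proof.
move=> r0 eq_ij; apply: mutual_projection => //; apply/eqP.
  by rewrite -polar_normal_line eq_ij polar_normal_line subrr cos0 mulr1.
by rewrite -polar_normal_line -eq_ij polar_normal_line subrr cos0 mulr1.
Qed.

(** [D] is the set of signed distances of the orbits. *)
Definition star (D : {fset R}) : {fset R * R} :=
  (0, 0) |` [fset polar (dir q.1) (val q.2) | q : 'I_m * D in {: 'I_m * D}].

Variable D : {fset R}.
Hypothesis D0 : 0 \notin D.

Lemma D_neq0 r : r \in D -> r != 0.
Proof. by apply: contraTneq => ->. Qed.

Lemma starP p :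
  reflect (p = (0, 0) \/
           exists c : 'I_m, exists2 r, r \in D & p = polar (dir c) r)
          (p \in star D).
Proof.
rewrite !inE; apply: (iffP orP) => [[/eqP->|/imfsetP[[c r] _ ->]]|].
- by left.
- by right; exists c, (val r); rewrite ?(valP r).
case=> [->|[c [r rD ->]]]; first by left.
by right; apply/imfsetP; exists (c, [` rD]).
Qed.

Lemma card_star : #|` star D| = (m * #|` D|).+1.
Proof.
rewrite /star cardfsU1 card_imfset_fin.
  rewrite card_prod card_ord -cardfE; case: imfsetP => // -[[c r] _].
  move/(congr1 (fun p => p \in normal_line (dir c) (val r))).
  rewrite origin_normal_line polar_normal_line subrr cos0 mulr1 eqxx.
  by rewrite (negPf (D_neq0 (valP r))).
move=> [c r] [d s] _ _ /= /polar_inj[|-> /val_inj->//].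
by rewrite D_neq0 ?(valP r).
Qed.

Definition axis (i : nat) : set (R * R) := normal_line (dir i + pi / 2) 0.

Lemma polar_axis (c i : 'I_m) r :
  r != 0 -> (polar (dir c) r \in axis i) = (c == i).
Proof.
move=> r0; rewrite polar_normal_line mulf_eq0 (negPf r0) /=.
rewrite opprD addrA cosBpihalf.
rewrite -norm_cos_eq1; apply/eqP/eqP => [|->]; first exact: normr_cos_angleB.
by rewrite subrr cos0 normr1.
Qed.

Lemma card_star_axis (i : 'I_m) :
  #|` [fset p in star D | p \in axis i]| = #|` D|.+1.
Proof.
have -> : [fset p in star D | p \in axis i] =
    (0, 0) |` [fset polar (dir i) r | r in D].
  apply/fsetP => p; rewrite mem_fset_on_line [RHS]in_fset1U.
  apply/andP/orP => [[/starP[->|[c [r rD ->]]]]|[/eqP->|/imfsetP[r rD ->]]].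
  - by left.
  - by rewrite polar_axis ?D_neq0 // => /eqP->; right; apply/imfsetP; exists r.
  - by rewrite origin_normal_line eqxx; split=> //; apply/starP; left.
  - rewrite polar_axis ?D_neq0 // eqxx; split=> //; apply/starP; right.
    by exists i, r.
rewrite cardfsU1 card_in_imfset /=; last first.
  by move=> r s rD _ /polar_inj[|//]; rewrite D_neq0.
case: imfsetP => // -[r rD].
move/(congr1 (fun p => p \in normal_line (dir i) r)).
rewrite origin_normal_line polar_normal_line subrr cos0 mulr1 eqxx.
by rewrite (negPf (D_neq0 rD)).
Qed.

(** The line meets each axis c <> i in one point, at distance s / cos, which is
    an element of [D]; on its own axis i the distance is s, which is not. *)
Lemma card_star_tangent (s : R) (i : 'I_m) :
    s != 0 -> s \notin D ->
    (forall d, (0 < d < m)%N -> s / vcos d \in D) ->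
  #|` [fset p in star D | p \in normal_line (dir i) s]| = h.*2.
Proof.
move=> s0 sD sVD.
have -> : [fset p in star D | p \in normal_line (dir i) s] =
    [fset polar (dir c) (s / cos (dir c - dir i)) | c : 'I_m in predC1 i].
  apply/fsetP => p; rewrite mem_fset_on_line.
  apply/andP/imfsetP => /= [[/starP[->|[c [r rD ->]]]]|[c ci ->]].
  - by rewrite origin_normal_line (negPf s0).
  - rewrite polar_normal_line => /eqP rs; exists c; last first.
      by rewrite -rs mulfK ?cos_angleB_neq0.
    rewrite inE; apply: contraNneq sD => ci.
    by move: rs; rewrite ci subrr cos0 mulr1 => <-.
  - rewrite polar_normal_line divfK ?cos_angleB_neq0 //; split=> //.
    apply/starP; right; exists c, (s / cos (dir c - dir i)) => //.
    rewrite cos_angleB sVD //; move: ci; rewrite inE -val_eqE.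
    by case: c i => c ? [i ?] /=; lia.
rewrite card_in_imfset; last first.
  move=> c d _ _ /polar_inj[|//].
  by rewrite mulf_neq0 ?invr_eq0 ?cos_angleB_neq0.
rewrite -(card_uniqP (enum_finmem_uniq _)) (eq_card (enum_finmemE _)).
by have := cardC1 i; rewrite card_ord.
Qed.

(** All 3m lines at once: [None] stands for the axes, [Some false] for the side
    lines and [Some true] for those of the copy scaled by [k]. *)
Definition star_line (k : R) (q : 'I_m * option bool) : set (R * R) :=
  if q.2 is Some b then normal_line (dir q.1) (if b then k else 1)
  else axis q.1.

Lemma star_line_inj (k : R) : k != 0 -> k != 1 -> injective (star_line k).
Proof.
move=> k0 k1.
have tangent0 (i : 'I_m) (b : option bool) :
    ((0, 0) \in star_line k (i, b)) = ~~ b.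
  by case: b => [[]|]; rewrite origin_normal_line ?eqxx ?oner_eq0 ?(negPf k0).
move=> [i b] [j c] eq_L; have := tangent0 i b; rewrite eq_L tangent0.
case: b c eq_L => [b|] [c|] //= eq_L _; last first.
  have := polar_axis i i (oner_neq0 R).
  rewrite eqxx -[axis i]/(star_line k (i, None)).
  by rewrite eq_L /star_line polar_axis ?oner_neq0 // => /eqP->.
move: eq_L; rewrite /star_line /=; set s := if b then _ else _.
set t := if c then _ else _ => eq_L.
have s0 : s != 0 by rewrite /s; case: b {s eq_L}; rewrite ?oner_neq0.
have [] : i = j /\ s = t.
  apply: mutual_projection => //; apply/eqP.
    by rewrite -polar_normal_line -eq_L polar_normal_line subrr cos0 mulr1.
  by rewrite -polar_normal_line eq_L polar_normal_line subrr cos0 mulr1.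
move=> -> /eqP; rewrite /s /t.
by case: b c {s t eq_L s0} => [] [] //; rewrite ?[1 == k]eq_sym (negPf k1).
Qed.

End Star.

(** * The distances of the orbits *)

Section Radii.
Variables (R : realType) (h : nat).
Hypothesis h_gt1 : 1 < h.
Notation m := h.*2.+1.
Notation vcos := (vertex_cos R h).
Notation lam := (star_ratio R h).
Local Open Scope ring_scope.

Definition tangent_radii (s : R) : {fset R} :=
  [fset s / vcos d.+1 | d : 'I_h in 'I_h].

Definition radii : {fset R} := tangent_radii 1 `|` tangent_radii lam.

Lemma tangent_radiiP s r :
  reflect (exists2 d, (0 < d <= h)%N & r = s / vcos d) (r \in tangent_radii s).
Proof.
apply: (iffP (imfsetP _ _ _ _)) => /= -[d dh ->].
  by exists d.+1 => //=; exact: ltn_ord.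
case: d dh => // d dh; by exists (Ordinal (dh : (d < h)%N)).
Qed.

(** Indices above h give nothing new, by the symmetry d -> m - d. *)
Lemma tangent_radius_mem s d : (0 < d < m)%N -> s / vcos d \in tangent_radii s.
Proof.
move=> dm; apply/tangent_radiiP; case: (leqP d h) => dh.
  by exists d => //; lia.
by exists (m - d)%N; rewrite ?vertex_cosC //; lia.
Qed.

Lemma card_tangent_radii s : s != 0 -> #|` tangent_radii s| = h.
Proof.
move=> s0; rewrite card_imfset_fin ?card_ord // => d e _ _.
move=> /(mulfI s0)/invr_inj/vertex_cos_inj; rewrite !inE !ltn_ord.
by move=> /(_ h_gt1 isT isT)[] /val_inj.
Qed.

Lemma star_ratio_neq0 : lam != 0.
Proof.
by rewrite mulf_neq0 ?invr_eq0 ?vertex_cos_h_neq0 ?vertex_cos_nearest_neq0.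
Qed.

Lemma star_ratio_neq1 : lam != 1.
Proof.
by apply: contraTneq (normr_star_ratio_gt1 R h_gt1) => ->; rewrite normr1 ltxx.
Qed.

(** The common distance is the one given by the smallest cosine: in
    absolute value it is the largest in the first set and the smallest in the
    second one. *)
Lemma radii_overlap :
  tangent_radii 1 `&` tangent_radii lam = [fset (vcos (nearest h))^-1].
Proof.
apply/fsetP => r; rewrite in_fsetI in_fset1; apply/andP/eqP => [[]|->].
  move=> /tangent_radiiP[e eh ->] /tangent_radiiP[d dh].
  by rewrite div1r => /esym/(star_ratio_coincidence h_gt1 dh eh)->.
split; apply/tangent_radiiP.
  by exists (nearest h); rewrite ?div1r // nearest_bounds.
exists h; first by rewrite leqnn andbT ltnW.
by rewrite /star_ratio mulrAC mulfV ?div1r ?vertex_cos_h_neq0.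
Qed.

Lemma card_radii : #|` radii| = h.*2.-1.
Proof.
rewrite cardfsU radii_overlap cardfs1.
by rewrite !card_tangent_radii ?oner_neq0 ?star_ratio_neq0 // addnn subn1.
Qed.

Lemma normr_inv_vertex_cos_gt1 d : (0 < d <= h)%N -> 1 < `|(vcos d)^-1|.
Proof.
move=> dh; have dm : (0 < d < m)%N by lia.
rewrite normfV invf_gt1 ?normr_vertex_cos_lt1 // normr_gt0.
by rewrite vertex_cos_neq0 //; case/andP: dm.
Qed.

Lemma one_notin_radii : 1 \notin radii.
Proof.
rewrite in_fsetU; apply/norP; split; apply/tangent_radiiP => -[d dh].
all: have lt1 := normr_inv_vertex_cos_gt1 dh.
all: move=> /(congr1 Num.norm); rewrite normrM normr1 => eq1.
  by move: lt1; rewrite {1}eq1 mul1r ltxx.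
have := normr_star_ratio_gt1 R h_gt1; nra.
Qed.

(** For the scaled distances, the ratio cancels and 1 / cos = 1 remains. *)
Lemma star_ratio_notin_radii : lam \notin radii.
Proof.
rewrite in_fsetU; apply/norP; split; apply/tangent_radiiP => -[d dh].
  by rewrite div1r; apply/eqP/star_ratio_neqV.
rewrite -[LHS]mulr1 => /(mulfI star_ratio_neq0) eq1.
by have := normr_inv_vertex_cos_gt1 dh; rewrite -eq1 normr1 ltxx.
Qed.

Lemma zero_notin_radii : 0 \notin radii.
Proof.
rewrite in_fsetU; apply/norP; split; apply/tangent_radiiP => -[d dh] /esym/eqP.
all: rewrite mulf_eq0 invr_eq0 (negPf (vertex_cos_neq0 _ _ _)) ?orbF; [|lia..].
  by rewrite oner_eq0.
by rewrite (negPf star_ratio_neq0).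
Qed.

End Radii.

Lemma rich_star (R : realType) (h : nat) (h_gt1 : 1 < h) :
  exists (S : {fset R * R}) (Ls : {fset (set (R * R))}),
    [/\ #|` S| = h.*2 ^ 2, #|` Ls| = 3 * h.*2 + 3
      & {subset Ls <= rich_lines h.*2 S}].
Proof.
have D0 := zero_notin_radii R h_gt1.
have k0 := star_ratio_neq0 R h_gt1.
pose lines := star_line (R := R) (h := h) (star_ratio R h).
exists (star h (radii R h)), [fset lines q | q in {: 'I_h.*2.+1 * option bool}].
split.
- rewrite card_star // card_radii // -mulnn.
  case: h h_gt1 {D0 k0 lines} => // h _.
  by rewrite doubleS /=; lia.
- rewrite card_imfset_fin; last first.
    by move=> p q _ _; apply: star_line_inj; rewrite ?star_ratio_neq1.
  by rewrite card_prod card_ord card_option card_bool; lia.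
move=> _ /imfsetP[[i b] _ ->]; rewrite inE; split.
  by case: b => [b|]; exact: is_line_normal_line.
case: b => [b|]; last first.
  by rewrite card_star_axis // card_radii //; case: h h_gt1 {D0 k0 lines} i.
apply: card_star_tangent => //; case: b => //=; rewrite ?oner_neq0 //.
- exact: star_ratio_notin_radii.
- exact: one_notin_radii.
- by move=> d dm; rewrite in_fsetU tangent_radius_mem ?orbT.
- by move=> d dm; rewrite in_fsetU tangent_radius_mem.
Qed.

(** * The maximal number of rich lines *)

Section MaxRichLines.
Variable R : realType.
Local Open Scope ring_scope.

Lemma line_eq_of_two_points (L M : set (R * R)) p q : is_line L -> is_line M ->
  p != q -> p \in L -> q \in L -> p \in M -> q \in M -> L = M.
Proof.
suff sub (K N : set (R * R)) : is_line K -> is_line N -> p != q ->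
    p \in K -> q \in K -> p \in N -> q \in N -> (K `<=` N)%classic.
  by move=> lL lM pq pL qL pM qM; apply/seteqP; split; exact: sub.
case: p q => [p1 p2] [q1 q2].
move=> [a [b [c [ab ->]]]] [a' [b' [c' [_ ->]]]] pq; rewrite !inE /=.
move=> pK qK pN qN [z1 z2] /= zK.
(* Both lines are orthogonal to p - q <> 0, so their normals are parallel. *)
have colN : a' * b = b' * a.
  have e1 : a * (p1 - q1) + b * (p2 - q2) = 0.
    by rewrite !mulrBr addrACA -opprD pK qK subrr.
  have e2 : a' * (p1 - q1) + b' * (p2 - q2) = 0.
    by rewrite !mulrBr addrACA -opprD pN qN subrr.
  apply/eqP; rewrite -subr_eq0; apply: contraNT pq => det0.
  rewrite xpair_eqE -!(subr_eq0 _ q1) -!(subr_eq0 _ q2).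
  rewrite -(mulrI_eq0 _ (mulfI det0)) -(mulrI_eq0 (p2 - q2) (mulfI det0)).
  apply/andP; split; apply/eqP.
    transitivity (b * (a' * (p1 - q1) + b' * (p2 - q2))
      - b' * (a * (p1 - q1) + b * (p2 - q2))); first ring.
    by rewrite e1 e2 !mulr0 subrr.
  transitivity (a' * (a * (p1 - q1) + b * (p2 - q2))
    - a * (a' * (p1 - q1) + b' * (p2 - q2))); first ring.
  by rewrite e1 e2 !mulr0 subrr.
(* Parallel normals and the common point p: the equation of N, multiplied by
   either coefficient of K, follows from that of K. *)
have aE : a * (a' * z1 + b' * z2 - c') = 0.
  transitivity (a' * (a * (z1 - p1) + b * (z2 - p2))
     + (b' * a - a' * b) * (z2 - p2)
     + a * (a' * p1 + b' * p2 - c')); first ring.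
  rewrite pN colN !subrr mul0r !mulr0 !mulrBr addrACA -opprD zK pK.
  by rewrite subrr mulr0 !addr0.
have bE : b * (a' * z1 + b' * z2 - c') = 0.
  transitivity (b' * (a * (z1 - p1) + b * (z2 - p2))
     + (a' * b - b' * a) * (z1 - p1)
     + b * (a' * p1 + b' * p2 - c')); first ring.
  rewrite pN colN !subrr mul0r !mulr0 !mulrBr addrACA -opprD zK pK.
  by rewrite subrr mulr0 !addr0.
apply/eqP; rewrite -subr_eq0; apply/negPn/negP => z0; apply: ab.
move/eqP: aE; move/eqP: bE.
by rewrite !mulf_eq0 (negPf z0) !orbF => /eqP-> /eqP->.
Qed.

(** A trace with two distinct points determines the line. *)
Lemma rich_lines_trace_inj (k : nat) (S : {fset R * R}) : (1 < k)%N ->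
  {in rich_lines k S &, injective (fun L => [fset p in S | p \in L])}.
Proof.
move=> k1 L M; rewrite !inE => -[lL cL] [lM _] eqLM.
have [p pT] : exists p, p \in [fset p in S | p \in L].
  by apply/fset0Pn; rewrite -cardfs_gt0 cL ltnW.
have [q] : exists q, q \in [fset p in S | p \in L] `\ p.
  apply/fset0Pn; rewrite -cardfs_gt0.
  by have := cardfsD1 p [fset p in S | p \in L]; rewrite pT cL; lia.
rewrite in_fsetD1 => /andP[qp qT].
have := pT; have := qT; rewrite eqLM; move: pT qT; rewrite !mem_fset_on_line.
move=> /andP[_ pL] /andP[_ qL] /andP[_ qM] /andP[_ pM].
by apply: line_eq_of_two_points qp qL pL qM pM.
Qed.

Lemma finite_rich_lines (k : nat) (S : {fset R * R}) :
  (1 < k)%N -> finite_set (rich_lines k S).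
Proof.
move=> k1; pose trace (L : set (R * R)) := [fset p in S | p \in L].
pose line_of T := xget set0 [set L | rich_lines k S L /\ trace L = T].
apply: (@sub_finite_set _ _ (line_of @` [set` fpowerset S])); last first.
  by apply: finite_image; exact: finite_fset.
move=> L SL; exists (trace L).
  rewrite /= fpowersetE; apply/fsubsetP => p.
  by rewrite mem_fset_on_line => /andP[].
apply: xget_unique => // M [SM].
by apply: rich_lines_trace_inj k1 _ _ _ _; exact: mem_set.
Qed.

Lemma num_rich_lines_le (k : nat) (S : {fset R * R}) :
  (1 < k)%N -> (num_rich_lines k S <= 2 ^ #|` S|)%N.
Proof.
move=> k1; rewrite -card_fpowerset /num_rich_lines.
have fin := finite_rich_lines S k1.
have /card_in_imfsetP/eqP <- : {in fset_set (rich_lines k S) &,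
    injective (fun L : set (R * R) => [fset p in S | p \in L])}.
  by move=> L M; rewrite !in_fset_set //; exact: rich_lines_trace_inj.
apply: fsubset_leq_card; apply/fsubsetP => _ /imfsetP[L _ ->].
by rewrite fpowersetE; apply/fsubsetP => p; rewrite mem_fset_on_line => /andP[].
Qed.

(** The number of [k]-rich lines is bounded over all sets of a given size, so
    the maximum exists and the default value of [xget] is not used. *)
Lemma num_rich_lines_le_max (k : nat) (S : {fset R * R}) :
  (1 < k)%N -> (num_rich_lines k S <= max_rich_lines R k #|` S|)%N.
Proof.
move=> k1; set c := #|` S|.
pose attained (t : nat) :=
  `[< exists2 T : {fset R * R}, #|` T| = c & num_rich_lines k T = t >].
have att_ex : exists t, attained t.
  by exists (num_rich_lines k S); apply/asboolP; exists S.
have att_le t : attained t -> (t <= 2 ^ c)%N.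
  by move=> /asboolP[T <- <-]; exact: num_rich_lines_le.
suff [_ ->//] : is_max_rich R k c (max_rich_lines R k c).
apply: xgetPex; exists (ex_maxn att_ex att_le).
case: ex_maxnP => t /asboolP[T cT nT] tmax.
split; first by exists T.
by move=> U cU; apply: tmax; apply/asboolP; exists U.
Qed.

End MaxRichLines.

Theorem mainTheorem3 (R : realType) (n : nat) (hn : 2 < n) (hev : ~~ odd n) :
  (exists (S : {fset R * R}) (Ls : {fset (set (R * R))}),
     [/\ #|` S| = n ^ 2,
         #|` Ls| = 3 * n + 3
       & forall L, L \in Ls ->
           is_line L /\ #|` [fset p in S | p \in L]| = n]) /\
  3 * n + 3 <= max_rich_lines R n (n ^ 2).
Proof.
have h_gt1 : 1 < n./2 by lia.
have [S [Ls [cS cLs rich]]] := rich_star R h_gt1.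
have nE : n./2.*2 = n by rewrite even_halfK.
rewrite nE in cS cLs rich.
split; first by exists S, Ls; split=> // L /rich; rewrite inE.
rewrite -cS -cLs; apply: leq_trans (num_rich_lines_le_max S (ltnW hn)).
apply: fsubset_leq_card; apply/fsubsetP => L /rich.
by rewrite in_fset_set //; apply: finite_rich_lines; rewrite ltnW.
Qed.
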